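(* Consider the system $x_{k+1}=Ax_k+Bw_k$, $y^i_k=C^ix_k+D^iv^i_k$ ($i\in\mathcal V=\{1,\dots,N\}$) and the DIO (described in the context) run with fixed gains $L^i,\Gamma^i$ and $d\in\mathbb N$ network iterations. The noise-free collective error dynamics $e_{k+1}=H_k\hat A e_k$ (obtained when $\underline w=\overline w=0$, $\underline v^i=\overline v^i=0$) is globally exponentially stable if and only if there exists $H_*\in\mathcal H_d$ such that $H_*\hat A$ is Schur stable (spectral radius $<1$). Consequently, the DIO is input-to-state stable (i.e. a distributed interval observer) if and only if such an $H_*$ exists.
   Context: Entrywise inequalities/max/min; $M^+_{ij}=\max\{M_{ij},0\}$, $M^-=M^+-M$. System data: $x_0\in[\underline x_0,\overline x_0]$, $w_k\in[\underline w,\overline w]$, $v^i_k\in[\underline v^i,\overline v^i]$. $G=(\mathcal V,E)$ directed, $\mathcal N_i=\{j:(i,j)\in E\}\cup\{i\}$, $\mathcal N_i^d$ = nodes reachable from $i$ by a directed path of length $\le d$ (including $i$). DIO: $T^i=I_n-\Gamma^iC^i$, $\tilde A^i=T^iA-L^iC^i$; $\underline x^i_0=\underline x_0$, $\overline x^i_0=\overline x_0$; for each $k$, $\underline x^{i,0}_{k+1}=(\tilde A^i)^+\underline x^i_k-(\tilde A^i)^-\overline x^i_k+(T^iB)^+\underline w-(T^iB)^-\overline w+L^iy^i_k+\Gamma^iy^i_{k+1}-((L^iD^i)^++(\Gamma^iD^i)^+)\overline v^i+((L^iD^i)^-+(\Gamma^iD^i)^-)\underline v^i$, $\overline x^{i,0}_{k+1}=(\tilde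 A^i)^+\overline x^i_k-(\tilde A^i)^-\underline x^i_k+(T^iB)^+\overline w-(T^iB)^-\underline w+L^iy^i_k+\Gamma^iy^i_{k+1}-((L^iD^i)^++(\Gamma^iD^i)^+)\underline v^i+((L^iD^i)^-+(\Gamma^iD^i)^-)\overline v^i$, then $\underline x^i_{k+1}=\max_{j\in\mathcal N_i^d}\underline x^{j,0}_{k+1}$, $\overline x^i_{k+1}=\min_{j\in\mathcal N_i^d}\overline x^{j,0}_{k+1}$. Errors $\underline e^i_k=x_k-\underline x^i_k$, $\overline e^i_k=\overline x^i_k-x_k$, $e_k=[(\underline e^1_k)^\top\ (\overline e^1_k)^\top\cdots(\underline e^N_k)^\top\ (\overline e^N_k)^\top]^\top\in\mathbb R^{2Nn}$. $\hat A=\mathrm{diag}(\hat A^1,\dots,\hat A^N)$ with $\hat A^i=\begin{bmatrix}(\tilde A^i)^+&(\tilde A^i)^-\\(\tilde A^i)^-&(\tilde A^i)^+\end{bmatrix}$. In the noise-free case, $e_{k+1}=H_k\hat A e_k$ where $H_k\in\{0,1\}^{2Nn\times2Nn}$ has row $2n(i-1)+s$ equal to $\mathbf e^\top_{2n(j-1)+s}$ with $j$ the smallest index maximizing $(\underline x^{j,0}_{k+1})_s$ over $\mathcal N_i^d$, and row $2n(i-1)+n+s$ equal to $\mathbf e^\top_{2n(j'-1)+n+s}$ with $j'$ the smallest index minimizing $(\overline x^{j',0}_{k+1})_s$ over $\mathcal N_i^d$. $\mathcal H_d$ is the set of all $H\in\{0,1\}^{2Nn\times2Nn}$ such that for every $i\in\mathcal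 V$, $s\in\{1,\dots,n\}$ there exist $j,j'\in\mathcal N_i^d$ with row $2n(i-1)+s$ of $H$ equal to $\mathbf e^\top_{2n(j-1)+s}$ and row $2n(i-1)+n+s$ equal to $\mathbf e^\top_{2n(j'-1)+n+s}$ (these are exactly the matrices that arise as $H_k$ for some framer values). Global exponential stability: there exist $c>0$, $\lambda\in(0,1)$ with $\|e_k\|\le c\lambda^k\|e_0\|$ for all $k$ and all initial data. Input-to-state stability of the DIO: there exist $\beta\in\mathcal{KL}$ and $\gamma\in\mathcal K_\infty$ such that $\|e_k\|\le\beta(\|e_0\|,k)+\gamma(\max_{0\le l\le k}\|\Delta_l\|)$ for all $k\ge0$ and all admissible realizations, where $\Delta_l=[w_l^\top\ (v^1_l)^\top\cdots(v^N_l)^\top]^\top$.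
   Formalization: In the ISS claim, Δ_l is taken to include the noise bounds (w and v^i, lower and upper) together with the realizations, and β, γ are uniform over all bounds; with realizations alone the claim fails (zero noise inside a nontrivial interval still makes e_1 nonzero from e_0=0). *)

(* Defs.v *)
From HB Require Import structures.
From mathcomp Require Import all_boot all_order all_algebra.
From mathcomp Require Import all_classical all_reals all_analysis.
From mathcomp Require Import complex.
Set Implicit Arguments. Unset Strict Implicit. Unset Printing Implicit Defensive.
Import Order.TTheory GRing.Theory Num.Theory.
Import numFieldNormedType.Exports.
Local Open Scope ring_scope.
Local Open Scope classical_set_scope.

Section Comparison.
Variable R : realType.

Definition nonneg_reals : set R := [set x | 0 <= x].

Definition classK (f : R -> R) : Prop :=
  f 0 = 0 /\ {within nonneg_reals, continuous f} /\
  (forall r s, 0 <= r -> r < s -> f r < f s).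

Definition classKinf (f : R -> R) : Prop :=
  classK f /\ (forall M : R, exists r, 0 <= r /\ M <= f r).

Definition classKL (b : R -> nat -> R) : Prop :=
  (forall k, classK (fun r => b r k)) /\
  (forall r, 0 <= r -> forall k, b r k.+1 <= b r k) /\
  (forall r, 0 <= r -> (fun k => b r k) @ \oo --> (0 : R)).
End Comparison.

Section MxHelpers.
Variable R : realType.

Definition mxpos m n (M : 'M[R]_(m, n)) : 'M[R]_(m, n) :=
  map_mx (fun x => Num.max x 0) M.
Definition mxneg m n (M : 'M[R]_(m, n)) : 'M[R]_(m, n) := mxpos M - M.

Definition schur_stable k (M : 'M[R]_k) : Prop :=
  forall z : R[i],
    eigenvalue (map_mx (fun x : R => (x%:C)%C) M) z ->
    ComplexField.Normc.normc z < 1.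

Definition vle n (u v : 'cV[R]_n) : Prop := forall s, u s 0 <= v s 0.

Definition vnorm n (u : 'cV[R]_n) : R := \big[Num.max/0]_(s < n) `|u s 0|.
End MxHelpers.

Fixpoint nbhd (N : nat) (E : rel 'I_N) (d : nat) (i : 'I_N) : {set 'I_N} :=
  if d is d'.+1 then
    nbhd E d' i :|: [set j | [exists l in nbhd E d' i, E l j]]
  else [set i].

Section DIO.
Variables (R : realType) (n m N : nat) (p q : 'I_N -> nat).
Variables (A : 'M[R]_n) (B : 'M[R]_(n, m))
          (C : forall i, 'M[R]_(p i, n)) (D : forall i, 'M[R]_(p i, q i))
          (L : forall i, 'M[R]_(n, p i)) (Gam : forall i, 'M[R]_(n, p i))
          (E : rel 'I_N) (d : nat).

Definition Tm i : 'M[R]_n := 1%:M - Gam i *m C i.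
Definition Atil i : 'M[R]_n := Tm i *m A - L i *m C i.

Variables (wl wu : 'cV[R]_m) (vl vu : forall i, 'cV[R]_(q i)).
Variables (x0 xl0 xu0 : 'cV[R]_n)
          (w : nat -> 'cV[R]_m) (v : nat -> forall i, 'cV[R]_(q i)).

Fixpoint xs (k : nat) : 'cV[R]_n :=
  if k is k'.+1 then A *m xs k' + B *m w k' else x0.
Definition ys (k : nat) (i : 'I_N) : 'cV[R]_(p i) :=
  C i *m xs k + D i *m v k i.

Definition framer0 (lo hi : 'I_N -> 'cV[R]_n) (k : nat) (j : 'I_N)
  : 'cV[R]_n * 'cV[R]_n :=
  let At := Atil j in let TB := Tm j *m B in
  let LD := L j *m D j in let GD := Gam j *m D j in
  (mxpos At *m lo j - mxneg At *m hi j + mxpos TB *m wl - mxneg TB *m wu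
     + L j *m ys k j + Gam j *m ys k.+1 j
     - (mxpos LD + mxpos GD) *m vu j + (mxneg LD + mxneg GD) *m vl j,
   mxpos At *m hi j - mxneg At *m lo j + mxpos TB *m wu - mxneg TB *m wl
     + L j *m ys k j + Gam j *m ys k.+1 j
     - (mxpos LD + mxpos GD) *m vl j + (mxneg LD + mxneg GD) *m vu j).

(* DIO framers (lower, upper) of all nodes at time k; the max/min over
   N_i^d is entrywise (i \in N_i^d, so the seed of the big max/min is one
   of the terms and does not change the value). *)
Fixpoint dio (k : nat) : ('I_N -> 'cV[R]_n) * ('I_N -> 'cV[R]_n) :=
  if k is k'.+1 then
    let lo := (dio k').1 in let hi := (dio k').2 in
    let f0 := framer0 lo hi k' in
    (fun i => \col_s \big[Num.max/(f0 i).1 s 0]_(j in nbhd E d i) (f0 j).1 s 0,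
     fun i => \col_s \big[Num.min/(f0 i).2 s 0]_(j in nbhd E d i) (f0 j).2 s 0)
  else (fun _ => xl0, fun _ => xu0).

(* || e_k ||  (infinity norm of the stacked error vector e_k) *)
Definition err_norm (k : nat) : R :=
  \big[Num.max/0]_(i < N)
     Num.max (vnorm (xs k - (dio k).1 i)) (vnorm ((dio k).2 i - xs k)).

Definition delta_norm (l : nat) : R :=
  Num.max (Num.max (vnorm (w l)) (Num.max (vnorm wl) (vnorm wu)))
    (\big[Num.max/0]_(i < N)
       Num.max (vnorm (v l i)) (Num.max (vnorm (vl i)) (vnorm (vu i)))).

End DIO.

(* Collective matrices.  Index (i, (b, s)) : 'I_N * ('I_2 * 'I_n), with *)
(* b = 0 lower / b = 1 upper; enum_rank gives the paper's ordering      *)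
(* 2n*i + n*b + s (0-based).                                            *)
Definition cidx (N n : nat) := ('I_N * ('I_2 * 'I_n))%type.
Notation CN N n := #|{: cidx N n}|.

Section Collective.
Variables (R : realType) (n N : nat) (p : 'I_N -> nat).
Variables (A : 'M[R]_n) (C : forall i, 'M[R]_(p i, n))
          (L : forall i, 'M[R]_(n, p i)) (Gam : forall i, 'M[R]_(n, p i)).

Definition Ahat : 'M[R]_(CN N n) :=
  \matrix_(r, c)
    let: (i, (b, s)) := enum_val r in
    let: (j, (b', s')) := enum_val c in
    if i == j then
      (if b == b' then mxpos (Atil A C L Gam i) s s'
       else mxneg (Atil A C L Gam i) s s')
    else 0.

Definition cpos (i : 'I_N) (b : 'I_2) (s : 'I_n) : 'I_(CN N n) :=
  enum_rank ((i, (b, s)) : cidx N n).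

Definition in_Hd (E : rel 'I_N) (d : nat) (H : 'M[R]_(CN N n)) : Prop :=
  (forall r c, H r c = 0 \/ H r c = 1) /\
  forall (i : 'I_N) (s : 'I_n),
    (exists2 j, j \in nbhd E d i &
       row (cpos i ord0 s) H = delta_mx 0 (cpos j ord0 s)) /\
    (exists2 j', j' \in nbhd E d i &
       row (cpos i 1 s) H = delta_mx 0 (cpos j' 1 s)).
End Collective.

(* Main.v *)
(* By the observer identity x_{k+1} = Atil x_k + TB w_k + L y_k + Gam y_{k+1}
   - LD v_k - GD v_{k+1}, the collective error satisfies
   e_{k+1} = min_H H (Ahat e_k + g_k) entrywise, with e_k >= 0 and a noise term
   g_k >= 0 bounded by the size of the disturbances; the minimum over H_d is
   attained row by row because the rows of H can be chosen independently.

   If H Ahat is Schur stable, nonnegativity gives u >= 1 with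
   H Ahat u = u - 1 <= mu u, and e_{k+1} <= H (Ahat e_k + g_k) yields
   e_k <= (mu^k |e_0| + |g| / (1 - mu)) u, hence both GES and ISS.

   Conversely, either stability notion makes the noise-free error started at the
   all-ones vector fall below 1/2 at some time.  Perturbing this trajectory
   slightly and taking the entrywise minimum u over a period gives u > 0 with
   min_H H Ahat u < u, so the minimizing H has H Ahat u < u and is Schur stable. *)
Require Import Defs.
From HB Require Import structures.
From mathcomp Require Import all_boot all_order all_algebra.
From mathcomp Require Import all_classical all_reals all_analysis.
From mathcomp Require Import complex.
From mathcomp Require Import ring lra.
Set Implicit Arguments. Unset Strict Implicit. Unset Printing Implicit Defensive.
Import Order.TTheory GRing.Theory Num.Theory.
Import numFieldNormedType.Exports.
Local Open Scope ring_scope.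

(** * Nonnegative matrices and Schur stability *)

Definition nonneg_mx (R : realType) m n (M : 'M[R]_(m, n)) : Prop :=
  forall i j, 0 <= M i j.

Lemma nonneg_mulmx (R : realType) m n q (M : 'M[R]_(m, n)) (M' : 'M[R]_(n, q)) :
  nonneg_mx M -> nonneg_mx M' -> nonneg_mx (M *m M').
Proof.
by move=> M0 M'0 i j; rewrite mxE; apply: sumr_ge0 => k _; rewrite mulr_ge0.
Qed.

Lemma mulmx_vle (R : realType) m n (M : 'M[R]_(m, n)) (x y : 'cV[R]_n) :
  nonneg_mx M -> vle x y -> vle (M *m x) (M *m y).
Proof.
by move=> M0 xy i; rewrite !mxE; apply: ler_sum => k _; rewrite ler_wpM2l.
Qed.

Lemma normcR (R : realType) (x : R) :
  ComplexField.Normc.normc (x%:C)%C = `|x|.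
Proof. by rewrite /= expr0n /= addr0 sqrtr_sqr. Qed.

Lemma normc_ge0 (R : realType) (z : R[i]) : 0 <= ComplexField.Normc.normc z.
Proof. by case: z => a b; exact: sqrtr_ge0. Qed.

Lemma normc_gt0 (R : realType) (z : R[i]) :
  z != 0 -> 0 < ComplexField.Normc.normc z.
Proof.
move=> z0; rewrite lt_def normc_ge0 andbT; apply: contra z0 => /eqP h.
exact/eqP/ComplexField.Normc.eq0_normc.
Qed.

Lemma normc_sum (R : realType) (I : finType) (F : I -> R[i]) :
  ComplexField.Normc.normc (\sum_i F i)
    <= \sum_i ComplexField.Normc.normc (F i).
Proof.
elim/big_ind2: _ => [|x a y b xa yb|//].
  by rewrite ComplexField.Normc.normc0.
exact: (le_trans (le_normcD (a : Rcomplex R) b) (lerD xa yb)).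
Qed.

(** Pairing the moduli [a] of a left eigenvector with [u] gives [|z| <a, u> <= <a, M u> < <a, u>],
    and [<a, u>] is positive. *)
Lemma schur_stable_subinvariant (R : realType) n (M : 'M[R]_n) (u : 'cV[R]_n) :
  nonneg_mx M -> (forall r, 0 < u r 0) -> (forall r, (M *m u) r 0 < u r 0) ->
  schur_stable M.
Proof.
move=> M0 u0 Mu z /eigenvalueP[v vM vn0].
pose a j := ComplexField.Normc.normc (v 0 j).
have a0 j : 0 <= a j by exact: normc_ge0.
have [j0 vj0] : exists j, v 0 j != 0.
  apply/existsP; apply: contra_neqT vn0 => /existsPn h; apply/matrixP => i j.
  by rewrite ord1 !mxE; apply/eqP; have := h j; rewrite negbK.
have aj0 : 0 < a j0 by exact: normc_gt0.
have za j : ComplexField.Normc.normc z * a j <= \sum_i a i * M i j.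
  rewrite -ComplexField.Normc.normcM.
  have -> : z * v 0 j = (z *: v) 0 j by rewrite mxE.
  rewrite -vM mxE (le_trans (normc_sum _))//.
  apply: ler_sum => i _.
  by rewrite !mxE ComplexField.Normc.normcM normcR (ger0_norm (M0 _ _)).
have S0 : 0 < \sum_j a j * u j 0.
  rewrite (bigD1 j0)//= ltr_pwDl ?mulr_gt0//.
  by apply: sumr_ge0 => j _; rewrite mulr_ge0// ltW.
rewrite -(ltr_pM2r S0) mul1r mulr_sumr.
apply: (@le_lt_trans _ _ (\sum_i a i * (M *m u) i 0)).
  apply: (@le_trans _ _ (\sum_j (\sum_i a i * M i j) * u j 0)).
    by apply: ler_sum => j _; rewrite mulrA ler_wpM2r// ltW.
  under eq_bigr do rewrite mulr_suml.
  rewrite exchange_big; apply: ler_sum => i _.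
  rewrite mxE mulr_sumr; apply: ler_sum => j _; by rewrite mulrA.
rewrite [ltLHS](bigD1 j0)// [ltRHS](bigD1 j0)//= ltr_leD// ?ltr_pM2l//.
by apply: ler_sum => j _; rewrite ler_wpM2l// ltW.
Qed.

Lemma cvg_bigmin (R : realType) n (f : 'I_n -> R -> R) (x : R) :
  (forall s, f s t @[t --> x] --> f s x)%classic ->
  (\big[Num.min/1]_s f s t @[t --> x] --> \big[Num.min/1]_s f s x)%classic.
Proof.
elim: n f => [|n IH] f cf.
  by rewrite big_ord0; under eq_fun do rewrite big_ord0; exact: cvg_cst.
rewrite big_ord_recl; under eq_fun do rewrite big_ord_recl.
apply: (@continuous_min _ _ (f ord0)
  (fun t => \big[Num.min/1]_(s < n) f (lift ord0 s) t) x).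
  exact: cf.
by apply: IH => s; exact: cf.
Qed.

(* Continuity in [t] of the solution [u t] of [u = 1 + t M u]: a nonnegative
   solution is at least 1, so its smallest entry cannot cross 1/2 as [t]
   increases from 0 to 1. *)
Lemma schur_stable_nonneg_resolvent (R : realType) n (M : 'M[R]_n) :
  nonneg_mx M -> schur_stable M ->
  exists u : 'cV[R]_n, (forall r, 1 <= u r 0) /\ M *m u = u - const_mx 1.
Proof.
move=> M0 sM.
(* With [1 - t M] written as an evaluated polynomial matrix, its determinant and adjugate are
   polynomial in [t], which yields continuity of the solution. *)
pose Px : 'M[{poly R}]_n := 1%:M - 'X *: map_mx polyC M.
pose Q t : 'M[R]_n := 1%:M - t *: M.
have QE t : Q t = map_mx (horner_eval t) Px.
  apply/matrixP => i j; rewrite !mxE /horner_eval hornerD hornerN hornerM.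
  by rewrite hornerX hornerC hornerMn hornerC.
have detQ t : \det (Q t) = (\det Px).[t] by rewrite QE det_map_mx.
(* A left kernel vector of [Q t] is an eigenvector of [M] for [1 / t >= 1], against Schur
   stability. *)
have det0 t : 0 <= t <= 1 -> \det (Q t) != 0.
  move=> /andP[t0 t1]; apply/negP => /det0P[v vn0 vQ].
  have vtM : t *: (v *m M) = v.
    by apply/eqP; rewrite eq_sym -subr_eq0 -{1}(mulmx1 v) scalemxAr -mulmxBr; apply/eqP.
  have tn0 : t != 0.
    by apply: contra vn0 => /eqP t00; rewrite -vtM t00 scale0r.
  have tp : 0 < t by rewrite lt_def tn0.
  suff /sM : eigenvalue (map_mx (fun x : R => (x%:C)%C) M) ((t^-1)%:C)%C.
    rewrite normcR ger0_norm ?invr_ge0// invf_lt1// => t1'.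
    by rewrite ltNge t1 in t1'.
  apply/eigenvalueP; exists (map_mx (real_complex R) v); last by rewrite map_mx_eq0.
  rewrite -[map_mx _ M]/(map_mx (real_complex R) M).
  by rewrite -map_mxM -[_%:C%C]/(real_complex R _) -map_mxZ -{2}vtM scalerA mulVf// scale1r.
pose u t : 'cV[R]_n := invmx (Q t) *m const_mx 1.
have uE t : 0 <= t <= 1 -> u t = const_mx 1 + t *: (M *m u t).
  move=> /det0 d0; have QU : Q t \in unitmx by rewrite unitmxE unitfE.
  have := mulKVmx QU (const_mx 1 : 'cV_n).
  rewrite -/(u t) mulmxBl mul1mx -scalemxAl.
  by move=> <-; rewrite subrK.
have u1 t : 0 <= t <= 1 -> (forall r, 0 <= u t r 0) -> forall r, 1 <= u t r 0.
  move=> t01 p r; rewrite (uE _ t01) !mxE lerDl mulr_ge0 ?(andP t01).1//.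
  by apply: sumr_ge0 => j _; rewrite mulr_ge0.
pose f t := \big[Num.min/1]_s u t s 0.
have cf t : 0 <= t <= 1 -> {for t, continuous f}.
  move=> t01; apply: (@cvg_bigmin _ _ (fun s t => u t s 0)) => s.
  have E : \forall y \near t, u y s 0 = (\sum_j (\adj Px) s j).[y] / (\det Px).[y].
    have : \forall y \near t, (\det Px).[y] != 0.
      have hc : ((\det Px).[y] @[y --> t] --> (\det Px).[t])%classic.
        exact: continuous_horner.
      by apply: cvgr_neq0 hc _; rewrite -detQ det0.
    apply: filterS => y dy; rewrite /u mxE horner_sum mulr_suml.
    apply: eq_bigr => j _; rewrite /invmx unitmxE unitfE detQ dy.
    rewrite [RHS]mulrC [const_mx _ _ _]mxE mulr1 [LHS]mxE; congr (_ * _).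
    by rewrite QE -map_mx_adj mxE.
  have c : ((\sum_j (\adj Px) s j).[y] / (\det Px).[y] @[y --> t] --> u t s 0)%classic.
    rewrite (nbhs_singleton E); apply: cvgM; first exact: continuous_horner.
    by apply: cvgV; [rewrite -detQ det0|exact: continuous_horner].
  apply: cvg_trans c; apply: near_eq_cvg.
  by apply: filterS E => y ->.
(* At the value 1/2 the solution would be nonnegative, hence at least 1 in every entry. *)
have fhalf t : 0 <= t <= 1 -> f t <> 1 / 2.
  move=> t01 ft.
  have p r : 1 / 2 <= u t r 0 by rewrite -ft; exact: bigmin_le.
  suff : 1 <= f t by rewrite ft; lra.
  apply/bigmin_geP; split=> // r _; apply: u1 => // r'.
  by have := p r'; lra.
have t0 : 0 <= (0 : R) <= 1 by rewrite lexx ler01.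
have t1 : 0 <= (1 : R) <= 1 by rewrite lexx ler01.
have f0 : 1 <= f 0.
  apply/bigmin_geP; split=> // r _.
  by rewrite (uE _ t0) scale0r addr0 mxE.
exists (u 1); split; last first.
  by rewrite {2}(uE _ t1) scale1r addrC addKr.
apply: u1 => // r.
suff : 1 / 2 <= f 1 by move=> /le_trans/(_ (bigmin_le _ r _)); lra.
rewrite leNgt; apply/negP => f1.
have cw : {within `[0, 1], continuous f}%classic.
  apply: continuous_in_subspaceT => t; rewrite inE/= in_itv/= => t01.
  exact: cf.
have [|c c01 fc] := IVT (v := 1 / 2) ler01 cw.
  by rewrite ge_min le_max (ltW f1) orbT /=; apply/orP; left; lra.
by apply: (@fhalf c) => //; move: c01; rewrite in_itv.
Qed.

(** * Neighbourhood minima and selector matrices *)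

Definition is_nbmin (R : realType) K (Nb : rel 'I_K) (y z : 'cV[R]_K) : Prop :=
  forall r, (forall t, Nb r t -> z r 0 <= y t 0) /\
            (exists2 t, Nb r t & z r 0 = y t 0).

Definition is_selector (R : realType) K (Nb : rel 'I_K) (H : 'M[R]_K) : Prop :=
  forall r, exists2 t, Nb r t & row r H = delta_mx 0 t.

Lemma row_delta_mulmx (R : realType) K (H : 'M[R]_K) r t (y : 'cV[R]_K) :
  row r H = delta_mx 0 t -> (H *m y) r 0 = y t 0.
Proof.
by move=> rH; have := row_mul r H y; rewrite rH -rowE => /matrixP/(_ 0 0); rewrite !mxE.
Qed.

Lemma selector_ge0 (R : realType) K (Nb : rel 'I_K) (H : 'M[R]_K) :
  is_selector Nb H -> nonneg_mx H.
Proof.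
move=> sH r c; have [t _ /matrixP/(_ 0 c)] := sH r.
by rewrite !mxE => ->; exact: ler0n.
Qed.

Lemma nbmin_selector_le (R : realType) K (Nb : rel 'I_K) (H : 'M[R]_K)
    (y z : 'cV[R]_K) :
  is_selector Nb H -> is_nbmin Nb y z -> vle z (H *m y).
Proof.
move=> sH yz r; have [t rt /row_delta_mulmx ->] := sH r.
exact: (yz r).1.
Qed.

(** A minimizing index is picked in each row separately; reflexivity makes [r] a valid first
    candidate. *)
Lemma nbmin_selector (R : realType) K (Nb : rel 'I_K) (y : 'cV[R]_K) :
  reflexive Nb -> exists2 H, is_selector Nb H & is_nbmin Nb y (H *m y).
Proof.
move=> Nbr; pose a r : 'I_K := [arg min_(t < r | Nb r t) y t 0]%O.
pose H : 'M[R]_K := \matrix_(r, c) (c == a r)%:R.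
have rH r : row r H = delta_mx 0 (a r).
  by apply/matrixP => i j; rewrite !mxE ord1.
exists H => r.
  by exists (a r) => //; rewrite /a; case: arg_minP.
rewrite (row_delta_mulmx _ (rH r)) /a.
by case: arg_minP => // t rt h; split=> // ; exists t.
Qed.

(** A minimizer for [y] is a candidate for [y']. With [a = 0] this is monotonicity and uniqueness of
    the minimum, with [a > 0] stability under a uniform excess. *)
Lemma nbmin_bound (R : realType) K (Nb : rel 'I_K) (y y' z z' : 'cV[R]_K) (a : R) :
  is_nbmin Nb y z -> is_nbmin Nb y' z' -> (forall r, y' r 0 <= y r 0 + a) ->
  forall r, z' r 0 <= z r 0 + a.
Proof.
move=> yz yz' h r; have [t rt ->] := (yz r).2.
exact: le_trans ((yz' r).1 t rt) (h t).
Qed.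

(* The perturbed iterates [z 0 = 1], [z k.+1 = min (P z k) + del] stay close to
   [e], so they come back below [z 0]; as the minimum map is monotone, the
   entrywise minimum [u] of one such period is strictly decreased by it, and the
   selector that is optimal at [u] is the one we want. *)
Lemma nbmin_contraction_selector (R : realType) K (Nb : rel 'I_K)
    (P : 'M[R]_K) (e : nat -> 'cV[R]_K) (k : nat) :
  reflexive Nb -> nonneg_mx P -> e 0%N = const_mx 1 ->
  (forall l, is_nbmin Nb (P *m e l) (e l.+1)) ->
  (forall r, e k.+1 r 0 <= 1 / 2) ->
  exists2 H, is_selector Nb H & schur_stable (H *m P).
Proof.
move=> Nbr P0 e0 eS ek.
have /boolp.choice[F Fmin] :
    forall y : 'cV[R]_K, exists z, is_nbmin Nb y z.
  by move=> y; have [H _ h] := nbmin_selector y Nbr; exists (H *m y).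
(* The sum of all entries bounds every row sum, so [P] enlarges a uniform excess by at most the
   factor [a]. *)
pose a := \sum_i \sum_j P i j.
have a0 : 0 <= a by apply: sumr_ge0 => i _; apply: sumr_ge0.
have Pa (x y : 'cV[R]_K) (c : R) : 0 <= c -> (forall r, x r 0 <= y r 0 + c) ->
    forall r, (P *m x) r 0 <= (P *m y) r 0 + a * c.
  move=> c0 xy r; rewrite !mxE.
  apply: (@le_trans _ _ (\sum_j (P r j * y j 0 + P r j * c))).
    by apply: ler_sum => j _; rewrite -mulrDr ler_wpM2l.
  rewrite big_split/= lerD2l -mulr_suml ler_wpM2r//.
  rewrite /a [leRHS](bigD1 r)//= lerDl; apply: sumr_ge0 => i _; exact: sumr_ge0.
(* [del * cc l] bounds the excess of [z l] over [e l]: a step multiplies it by at most [a] and adds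
   [del]. *)
pose cc := fix cc l := if l is l'.+1 then a * cc l' + 1 else 0 : R.
have cc0 l : 0 <= cc l.
  by elim: l => //= l IH; rewrite addr_ge0// mulr_ge0.
(* Small enough that the excess at time [k.+1] is at most 1/2, whence [z k.+1 <= 1 = z 0]. *)
pose del : R := (1 / 2) / (1 + cc k.+1).
have c1 : 0 < 1 + cc k.+1 by have := cc0 k.+1; lra.
have del0 : 0 < del by rewrite divr_gt0//; lra.
have delc : del * (1 + cc k.+1) = 1 / 2 by rewrite divfK// gt_eqF.
have del1 : del * cc k.+1 <= 1 / 2 by rewrite -delc ler_pM2l// lerDr.
have delle : del <= 1 / 2.
  by rewrite -delc ler_peMr ?(ltW del0)// lerDl.
pose z := fix z l : 'cV[R]_K :=
  if l is l'.+1 then F (P *m z l') + const_mx del else const_mx 1.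
have zS l r : z l.+1 r 0 = F (P *m z l) r 0 + del by rewrite /= !mxE.
have ze l r : z l r 0 <= e l r 0 + del * cc l.
  elim: l r => [|l IH] r; first by rewrite e0 /= mulr0 addr0.
  rewrite zS /= mulrDr mulr1 addrA lerD2r.
  rewrite mulrCA; apply: nbmin_bound (eS l) (Fmin _) _ r.
  by apply: Pa => //; rewrite mulr_ge0// ltW.
have zk r : z k.+1 r 0 <= 1 by have := ze k.+1 r; have := ek r; lra.
have z0 l r : del <= z l r 0.
  elim: l r => [|l IH] r; first by rewrite mxE; lra.
  rewrite zS lerDr; have [t _ ->] := (Fmin (P *m z l) r).2.
  rewrite mxE; apply: sumr_ge0 => j _; rewrite mulr_ge0//.
  exact: le_trans (ltW del0) (IH _).
(* The default 1 is the value of [z 0], so it is one of the terms. *)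
pose u : 'cV[R]_K := \col_r \big[Num.min/1]_(l < k.+1) z l r 0.
have uz l r : (l < k.+1)%N -> u r 0 <= z l r 0.
  by move=> lk; rewrite mxE; exact: (@bigmin_le _ _ _ _ (Ordinal lk) (fun i => z i r 0)).
have Fz l r : (l < k.+1)%N -> F (P *m u) r 0 + del <= z l.+1 r 0.
  move=> lk; rewrite zS lerD2r -[leRHS]addr0.
  apply: nbmin_bound (Fmin _) (Fmin _) _ r => r; rewrite addr0.
  by apply: mulmx_vle => // s; exact: uz.
have Fu r : F (P *m u) r 0 < u r 0.
  suff : F (P *m u) r 0 + del <= u r 0 by lra.
  (* Index [l.+1] is reached from [l]; index 0 and the default 1 are covered by [z k.+1 <= 1], which
     closes the period. *)
  rewrite [u r 0]mxE; apply/bigmin_geP; split.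
    exact: le_trans (Fz k r _) (zk r).
  move=> [[|l] lk] _ /=; last by apply: Fz; exact: ltnW.
  by rewrite mxE; exact: le_trans (Fz k r _) (zk r).
have [H sH HF] := nbmin_selector (P *m u) Nbr.
exists H => //; apply: (@schur_stable_subinvariant _ _ _ u).
- by apply: nonneg_mulmx => //; exact: selector_ge0 sH.
- move=> r; rewrite mxE; apply: lt_le_trans del0 _.
  by apply/bigmin_geP; split=> [|l _]; [lra|exact: z0].
- move=> r; apply: le_lt_trans (Fu r); rewrite -mulmxA -[leRHS]addr0.
  by apply: nbmin_bound (Fmin _) HF _ r => r'; rewrite addr0.
Qed.

(** The resolvent vector [u] serves as a weight: [1 <= u <= c] gives [H P u = u - 1 <= (1 - 1/c) u],
    so errors measured in units of [u] contract by [mu] up to the noise. *)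
Lemma nbmin_geometric_bound (R : realType) K (Nb : rel 'I_K) (P H : 'M[R]_K) :
  nonneg_mx P -> is_selector Nb H -> schur_stable (H *m P) ->
  exists c mu : R, [/\ 0 < c, 0 < mu, mu < 1 &
    forall (e g : nat -> 'cV[R]_K) (a b : R) (k : nat),
    0 <= a -> 0 <= b ->
    (forall l, is_nbmin Nb (P *m e l + g l) (e l.+1)) ->
    (forall r, e 0%N r 0 <= a) ->
    (forall l r, (l < k)%N -> g l r 0 <= b) ->
    forall r, e k r 0 <= c * mu ^+ k * a + c / (1 - mu) * b].
Proof.
move=> P0 sH sM; have H0 := selector_ge0 sH.
have [u [u1 Mu]] := schur_stable_nonneg_resolvent (nonneg_mulmx H0 P0) sM.
(* The summand 2 ensures [c > 1], hence [mu > 0]. *)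
pose c := 2 + \sum_r u r 0.
have u0 r : 0 <= u r 0 by exact: le_trans ler01 (u1 r).
have cu r : u r 0 <= c.
  rewrite /c (bigD1 r)//=.
  suff : 0 <= \sum_(i | i != r) u i 0 by lra.
  exact: sumr_ge0.
have c2 : 2 <= c by rewrite lerDl sumr_ge0.
have cp : 0 < c by lra.
pose mu := 1 - c^-1.
have ci : 0 < c^-1 by rewrite invr_gt0.
have ci1 : c^-1 < 1 by rewrite invf_lt1//; lra.
have mu0 : 0 < mu by rewrite /mu; lra.
have mu1 : mu < 1 by rewrite /mu; lra.
have Mmu r : (H *m P *m u) r 0 <= mu * u r 0.
  rewrite Mu !mxE /mu mulrBl mul1r lerD2l lerN2.
  by rewrite ler_pdivrMl// mulr1.
exists c, mu; split=> // e g a b k a0 b0 eS ea gb.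
(* [q] solves [q l.+1 = mu * q l + b] and starts above [a]. *)
pose q l := mu ^+ l * a + (1 - mu)^-1 * b.
have q0 l : 0 <= q l.
  by rewrite addr_ge0// mulr_ge0// ?exprn_ge0 ?invr_ge0 ?subr_ge0// ltW.
suff eq l : (l <= k)%N -> forall r, e l r 0 <= q l * u r 0.
  move=> r; apply: le_trans (eq k (leqnn k) r) _.
  rewrite -!mulrA -mulrDr mulrC; exact: ler_wpM2r.
elim: l => [_ r|l IH lk r].
  rewrite /q expr0 mul1r; apply: le_trans (ea r) _.
  rewrite -[leLHS]mulr1; apply: ler_pM => //.
  by rewrite lerDl mulr_ge0// invr_ge0 subr_ge0 ltW.
apply: le_trans (nbmin_selector_le sH (eS l) r) _.
have [t rt rH] := sH r.
rewrite mulmxDr [leLHS]mxE (row_delta_mulmx (g l) rH).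
have h1 : (H *m (P *m e l)) r 0 <= q l * (mu * u r 0).
  rewrite mulmxA; apply: le_trans (ler_wpM2l (q0 l) (Mmu r)).
  have -> : q l * (H *m P *m u) r 0 = (H *m P *m (q l *: u)) r 0.
    by rewrite -scalemxAr [in RHS]mxE.
  apply: mulmx_vle; first exact: nonneg_mulmx.
  by move=> s; rewrite mxE; apply: IH; exact: ltnW.
have h2 : g l t 0 <= b * u r 0.
  by apply: le_trans (gb _ _ lk) _; rewrite ler_peMr.
apply: le_trans (lerD h1 h2) _.
rewrite mulrA -mulrDl; apply: ler_wpM2r => //.
rewrite /q exprS le_eqVlt; apply/orP; left; apply/eqP; field.
by rewrite subr_eq0 gt_eqF.
Qed.

(** * Interval products and the collective index *)

(* With [a = x - l] and [b = h - x] (resp. exchanged), this is the distance from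
   [M x] to the lower (resp. upper) bound of the interval product [M [l, h]]. *)
Definition gap (R : realType) m n (M : 'M[R]_(m, n)) (a b : 'cV[R]_n) : 'cV[R]_m :=
  mxpos M *m a + mxneg M *m b.

(** The entrywise 1-norm, a crude bound for every row sum of absolute values. *)
Definition mxmass (R : realType) m n (M : 'M[R]_(m, n)) : R :=
  \sum_i \sum_j (mxpos M + mxneg M) i j.

Lemma mxpos_ge0 (R : realType) m n (M : 'M[R]_(m, n)) : nonneg_mx (mxpos M).
Proof. by move=> i j; rewrite mxE le_max lexx orbT. Qed.

Lemma mxneg_ge0 (R : realType) m n (M : 'M[R]_(m, n)) : nonneg_mx (mxneg M).
Proof. by move=> i j; rewrite !mxE subr_ge0 le_max lexx. Qed.

Lemma addmxE (R : realType) m n (M M' : 'M[R]_(m, n)) i j :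
  (M + M') i j = M i j + M' i j.
Proof. by rewrite mxE. Qed.

Lemma addmx3E (R : realType) m n (M M' M'' : 'M[R]_(m, n)) i j :
  (M + M' + M'') i j = M i j + M' i j + M'' i j.
Proof. by rewrite !mxE. Qed.

Lemma oppmxE (R : realType) m n (M : 'M[R]_(m, n)) i j : (- M) i j = - M i j.
Proof. by rewrite mxE. Qed.

Lemma gap_ge0 (R : realType) m n (M : 'M[R]_(m, n)) (a b : 'cV[R]_n) :
  nonneg_mx a -> nonneg_mx b -> nonneg_mx (gap M a b).
Proof.
move=> a0 b0 i j; rewrite addmxE addr_ge0//.
  exact: nonneg_mulmx (mxpos_ge0 M) a0 i j.
exact: nonneg_mulmx (mxneg_ge0 M) b0 i j.
Qed.

Lemma mxmass_ge0 (R : realType) m n (M : 'M[R]_(m, n)) : 0 <= mxmass M.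
Proof.
apply: sumr_ge0 => i _; apply: sumr_ge0 => j _; rewrite addmxE.
by rewrite addr_ge0// ?mxpos_ge0 ?mxneg_ge0.
Qed.

Lemma gap_le (R : realType) m n (M : 'M[R]_(m, n)) (a b : 'cV[R]_n) (c : R) i :
  0 <= c -> (forall s, a s 0 <= c) -> (forall s, b s 0 <= c) ->
  gap M a b i 0 <= mxmass M * c.
Proof.
move=> c0 ac bc; rewrite /gap addmxE [(mxpos M *m a) i 0]mxE [(mxneg M *m b) i 0]mxE.
rewrite -big_split /=.
apply: (@le_trans _ _ ((\sum_j (mxpos M + mxneg M) i j) * c)).
  rewrite mulr_suml; apply: ler_sum => j _; rewrite addmxE mulrDl.
  by apply: lerD; rewrite ler_wpM2l// ?mxpos_ge0 ?mxneg_ge0.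
rewrite ler_wpM2r// /mxmass [leRHS](bigD1 i)//= lerDl.
apply: sumr_ge0 => i' _; apply: sumr_ge0 => j _; rewrite addmxE.
by rewrite addr_ge0// ?mxpos_ge0 ?mxneg_ge0.
Qed.

Lemma ord2P (b : 'I_2) : b = ord0 \/ b = 1.
Proof. by case: b => [[|[|//]] i]; [left|right]; apply/val_inj. Qed.

Lemma rev_ord2 (b : 'I_2) : rev_ord b != b.
Proof. by case: b => [[|[|//]] h]. Qed.

Lemma rev_ord2P (b b' : 'I_2) : b' != b -> b' = rev_ord b.
Proof. by case: b b' => [[|[|//]] h] [[|[|//]] h'] //= _; apply/val_inj. Qed.

Lemma Ahat_ge0 (R : realType) n N (p : 'I_N -> nat) (A : 'M[R]_n)
    (C : forall i, 'M[R]_(p i, n)) (L Gam : forall i, 'M[R]_(n, p i)) :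
  nonneg_mx (Ahat A C L Gam).
Proof.
move=> r c; rewrite mxE; case: (enum_val r) => i [b s]; case: (enum_val c) => j [b' s'].
by case: eqP => // _; case: eqP => _; [exact: mxpos_ge0|exact: mxneg_ge0].
Qed.

Definition ccol (R : realType) n N (y : 'cV[R]_(CN N n)) (i : 'I_N) (b : 'I_2) :
  'cV[R]_n := \col_s y (cpos i b s) 0.

Lemma cposP n N (r : 'I_(CN N n)) : exists i b s, r = cpos i b s.
Proof.
rewrite -[r]enum_valK; case: (enum_val r) => i [b s].
by exists i, b, s.
Qed.

(** Only the two blocks of node [i] contribute; [rev_ord] exchanges lower and upper, and [mxneg]
    acts on the opposite side. *)
Lemma Ahat_mulmx (R : realType) n N (p : 'I_N -> nat) (A : 'M[R]_n)
    (C : forall i, 'M[R]_(p i, n)) (L Gam : forall i, 'M[R]_(n, p i))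
    (y : 'cV[R]_(CN N n)) i b s :
  (Ahat A C L Gam *m y) (cpos i b s) 0 =
  gap (Atil A C L Gam i) (ccol y i b) (ccol y i (rev_ord b)) s 0.
Proof.
rewrite mxE (reindex (fun c : cidx N n => enum_rank c)) /=; last first.
  exact: onW_bij (@enum_rank_bij _).
under eq_bigr => c _ do rewrite mxE !enum_rankK.
pose G j b' s' := (if i == j then
  if b == b' then mxpos (Atil A C L Gam i) s s' else mxneg (Atil A C L Gam i) s s'
  else 0) * y (cpos j b' s') 0.
transitivity (\sum_j \sum_b' \sum_s' G j b' s').
  under [RHS]eq_bigr => j _ do rewrite pair_bigA.
  by rewrite pair_bigA; apply: eq_bigr => -[j [b' s']].
rewrite (bigD1 i)//= [X in _ + X]big1 ?addr0; last first.
  move=> j ji; rewrite big1// => b' _; rewrite big1// => s' _.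
  by rewrite /G eq_sym (negbTE ji) mul0r.
rewrite /G eqxx.
rewrite (bigD1 b)//= eqxx (bigD1 (rev_ord b)) ?rev_ord2//=.
rewrite [b == rev_ord b]eq_sym (negbTE (rev_ord2 b)).
rewrite [X in _ + (_ + X)]big1 ?addr0; last first.
  by move=> b' /andP[/rev_ord2P -> /eqP].
by rewrite /gap addmxE !mxE; congr (_ + _); apply: eq_bigr => s' _;
  rewrite [ccol _ _ _ _ _]mxE.
Qed.

Lemma vnorm_ge (R : realType) n (u : 'cV[R]_n) s : `|u s 0| <= vnorm u.
Proof. exact: (le_bigmax _ (fun s => `|u s 0|)). Qed.

(** * The error recursion of the observer *)

Section Errors.
Variables (R : realType) (n m N : nat) (p q : 'I_N -> nat).
Variables (A : 'M[R]_n) (B : 'M[R]_(n, m))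
          (C : forall i, 'M[R]_(p i, n)) (D : forall i, 'M[R]_(p i, q i))
          (L : forall i, 'M[R]_(n, p i)) (Gam : forall i, 'M[R]_(n, p i))
          (E : rel 'I_N) (d : nat).

Definition cnbhd : rel 'I_(CN N n) := fun r t =>
  ((enum_val t).1 \in nbhd E d (enum_val r).1) &&
  ((enum_val r).2 == (enum_val t).2).

Lemma nbhd_refl k i : i \in nbhd E k i.
Proof. by elim: k => [|k IH] /=; rewrite !inE ?IH. Qed.

Lemma cnbhd_refl : reflexive cnbhd.
Proof. by move=> r; rewrite /cnbhd nbhd_refl eqxx. Qed.

Lemma cnbhd_cpos i b s t :
  reflect (exists2 j, j \in nbhd E d i & t = cpos j b s) (cnbhd (cpos i b s) t).
Proof.
rewrite /cnbhd /cpos enum_rankK /=; apply: (iffP andP) => [[jn /eqP e]|[j jn ->]].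
  exists (enum_val t).1 => //; rewrite e -[LHS]enum_valK; congr enum_rank.
  by case: (enum_val t).
by rewrite enum_rankK.
Qed.

Lemma in_Hd_selector (H : 'M[R]_(CN N n)) : in_Hd E d H <-> is_selector cnbhd H.
Proof.
split=> [[_ HE] r|sH].
  have [i [b [s ->]]] := cposP r; have [[j jn jr] [j' jn' jr']] := HE i s.
  have [->|->] := ord2P b.
    by exists (cpos j ord0 s) => //; apply/cnbhd_cpos; exists j.
  by exists (cpos j' 1 s) => //; apply/cnbhd_cpos; exists j'.
split=> [r c|i s].
  have [t _ /matrixP/(_ 0 c)] := sH r; rewrite !mxE eqxx /= => ->.
  by case: (c == t); [right|left].
have rowH b : exists2 j, j \in nbhd E d i & row (cpos i b s) H = delta_mx 0 (cpos j b s).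
  by have [t /cnbhd_cpos[j jn ->] ?] := sH (cpos i b s); exists j.
by split.
Qed.

Variables (wl wu : 'cV[R]_m) (vl vu : forall i, 'cV[R]_(q i)).
Variables (x0 xl0 xu0 : 'cV[R]_n)
          (w : nat -> 'cV[R]_m) (v : nat -> forall i, 'cV[R]_(q i)).

Local Notation x := (xs A B x0 w).
Local Notation lo k := (dio A B C D L Gam E d wl wu vl vu x0 xl0 xu0 w v k).1.
Local Notation hi k := (dio A B C D L Gam E d wl wu vl vu x0 xl0 xu0 w v k).2.
Local Notation f0 := (framer0 A B C D L Gam wl wu vl vu x0 w v).
Local Notation err := (err_norm A B C D L Gam E d wl wu vl vu x0 xl0 xu0 w v).
Local Notation TB i := (Tm C Gam i *m B).

(** Oriented so that a correct bound has a nonnegative error on either side. *)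
Definition side_err (b : 'I_2) (l y h : 'cV[R]_n) : 'cV[R]_n :=
  if b == ord0 then y - l else h - y.

Definition dio_err (k : nat) : 'cV[R]_(CN N n) :=
  \col_r let: (i, (b, s)) := enum_val r in
    side_err b (lo k i) (x k) (hi k i) s 0.

(** Measurement noise enters the observer identity with a minus sign, so its deviations stand in the
    order opposite to those of [w]. *)
Definition side_noise (b : 'I_2) (k : nat) (i : 'I_N) : 'cV[R]_n :=
  if b == ord0 then
    gap (TB i) (w k - wl) (wu - w k)
    + gap (L i *m D i) (vu i - v k i) (v k i - vl i)
    + gap (Gam i *m D i) (vu i - v k.+1 i) (v k.+1 i - vl i)
  else
    gap (TB i) (wu - w k) (w k - wl)
    + gap (L i *m D i) (v k i - vl i) (vu i - v k i)
    + gap (Gam i *m D i) (v k.+1 i - vl i) (vu i - v k.+1 i).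

Definition dio_noise (k : nat) : 'cV[R]_(CN N n) :=
  \col_r let: (i, (b, s)) := enum_val r in side_noise b k i s 0.

Lemma dio_errE k i b s :
  dio_err k (cpos i b s) 0 = side_err b (lo k i) (x k) (hi k i) s 0.
Proof. by rewrite mxE enum_rankK. Qed.

Lemma dio_noiseE k i b s : dio_noise k (cpos i b s) 0 = side_noise b k i s 0.
Proof. by rewrite mxE enum_rankK. Qed.

Lemma ccol_dio_err k i b :
  ccol (dio_err k) i b = side_err b (lo k i) (x k) (hi k i).
Proof. by apply/matrixP => s z; rewrite ord1 mxE dio_errE. Qed.

Lemma gapE m' n' (M : 'M[R]_(m', n')) a b : gap M a b = mxpos M *m (a + b) - M *m b.
Proof. by rewrite /gap /mxneg mulmxBl mulmxDr addrA. Qed.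

(** Since [Tm + Gam C = 1], the next state splits into [Tm x], expanded by the dynamics, and
    [Gam C x], expanded by the next output; [L (y - C x - D v) = 0] is then added. *)
Lemma xs_observer k i :
  x k.+1 = Atil A C L Gam i *m x k + TB i *m w k
           + L i *m ys A B C D x0 w v k i + Gam i *m ys A B C D x0 w v k.+1 i
           - L i *m D i *m v k i - Gam i *m D i *m v k.+1 i.
Proof.
have : Tm C Gam i *m x k.+1 = Tm C Gam i *m (A *m x k) + Tm C Gam i *m (B *m w k).
  exact: mulmxDr.
rewrite /ys; move: (x k.+1) => X TX.
have GC : Gam i *m (C i *m X) = X - Tm C Gam i *m X.
  by rewrite /Tm mulmxBl mul1mx mulmxA opprB addrC subrK.
rewrite !mulmxDr GC /Atil mulmxBl -!mulmxA TX.
by apply/matrixP => s z; rewrite !(addmxE, oppmxE); lra.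
Qed.

(** Subtraction from the observer identity cancels the outputs, and each interval product leaves a
    [gap]. *)
Lemma framer0_err (l h : 'I_N -> 'cV[R]_n) k i b :
  side_err b (f0 l h k i).1 (x k.+1) (f0 l h k i).2
  = gap (Atil A C L Gam i) (side_err b (l i) (x k) (h i))
        (side_err (rev_ord b) (l i) (x k) (h i))
    + side_noise b k i.
Proof.
rewrite (xs_observer k i) /framer0 /=.
set y := ys _ _ _ _ _ _ _ k i; set y' := ys _ _ _ _ _ _ _ k.+1 i.
have r0 : (rev_ord (ord0 : 'I_2) == ord0) = false by [].
have r1 : (rev_ord (1 : 'I_2) == ord0) = true by [].
(* Once [mxneg] is eliminated, each entry is an identity linear in products with [mxpos M] and
   [M]. *)
have [->|->] := ord2P b; rewrite /side_err /side_noise ?eqxx ?r0 ?r1 /= ?gapE;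
  rewrite /mxneg !(mulmxDl, mulmxDr, mulmxBl, mulmxBr, mulNmx, mulmxN);
  by apply/matrixP => s z; rewrite !(addmxE, oppmxE); lra.
Qed.

Lemma subr_bigmax (I : finType) (P : pred I) (F : I -> R) a c :
  c - \big[Num.max/a]_(i | P i) F i = \big[Num.min/c - a]_(i | P i) (c - F i).
Proof.
apply: (big_morph (fun z => c - z)) => // u u'.
by rewrite oppr_max addr_minr.
Qed.

Lemma bigmin_subr (I : finType) (P : pred I) (F : I -> R) a c :
  \big[Num.min/a]_(i | P i) F i - c = \big[Num.min/a - c]_(i | P i) (F i - c).
Proof.
apply: (big_morph (fun z => z - c)) => // u u'.
by rewrite addr_minl.
Qed.

(** Passing to errors turns the maximum of lower bounds and the minimum of upper bounds alike into a
    minimum, whose terms [framer0_err] computes. *)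
Lemma dio_err_step k :
  is_nbmin cnbhd (Ahat A C L Gam *m dio_err k + dio_noise k) (dio_err k.+1).
Proof.
move=> r; have [i [b [s ->]]] := cposP r.
set Y := _ + _.
pose F j := side_err b (f0 (lo k) (hi k) k j).1 (x k.+1)
  (f0 (lo k) (hi k) k j).2 s 0.
have YE j : Y (cpos j b s) 0 = F j.
  by rewrite addmxE Ahat_mulmx !ccol_dio_err dio_noiseE /F framer0_err [RHS]addmxE.
have EE : dio_err k.+1 (cpos i b s) 0 = \big[Num.min/F i]_(j in nbhd E d i) F j.
  rewrite dio_errE; have [eb|eb] := ord2P b.
    have FE j : F j = x k.+1 s 0 - (f0 (lo k) (hi k) k j).1 s 0.
      by rewrite /F eb /side_err eqxx addmxE oppmxE.
    under [RHS]eq_bigr do rewrite FE.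
    by rewrite FE eb /side_err eqxx addmxE oppmxE [lo _ _ _ _]mxE subr_bigmax.
  have FE j : F j = (f0 (lo k) (hi k) k j).2 s 0 - x k.+1 s 0.
    by rewrite /F eb /side_err addmxE oppmxE.
  under [RHS]eq_bigr do rewrite FE.
  by rewrite FE eb /side_err addmxE oppmxE [hi _ _ _ _]mxE bigmin_subr.
split=> [t /cnbhd_cpos[j jn ->]|].
  by rewrite EE YE; exact: bigmin_le_cond.
(* If the seed attains the minimum, the index is [i], which belongs to its own neighbourhood. *)
have [j jn Fj] : exists2 j, j \in nbhd E d i &
    \big[Num.min/F i]_(j in nbhd E d i) F j = F j.
  have /bigmin_leP := lexx (\big[Num.min/F i]_(j in nbhd E d i) F j).
  move=> [h|[j jn h]].
    exists i; first exact: nbhd_refl.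
    by apply/eqP; rewrite eq_le h bigmin_le_id.
  by exists j => //; apply/eqP; rewrite eq_le h bigmin_le_cond.
by exists (cpos j b s); [apply/cnbhd_cpos; exists j|rewrite EE YE].
Qed.

Lemma err_norm_ge0 k : 0 <= err k.
Proof. exact: bigmax_ge_id. Qed.

Lemma dio_err_le k r : `|dio_err k r 0| <= err k.
Proof.
have [i [b [s ->]]] := cposP r; rewrite dio_errE.
have := le_bigmax 0
  (fun i => Num.max (vnorm (x k - lo k i)) (vnorm (hi k i - x k))) i.
apply: le_trans; rewrite le_max.
by have [->|->] := ord2P b; rewrite /side_err /= vnorm_ge ?orbT.
Qed.

Lemma err_norm_le k (c : R) :
  0 <= c -> (forall r, `|dio_err k r 0| <= c) -> err k <= c.
Proof.
move=> c0 h; apply/bigmax_leP; split=> // i _; rewrite ge_max.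
by apply/andP; split; apply/bigmax_leP; split=> // s _;
  [have := h (cpos i ord0 s)|have := h (cpos i 1 s)]; rewrite dio_errE.
Qed.

Hypothesis x0l : vle xl0 x0.
Hypothesis x0u : vle x0 xu0.
Hypothesis wP : forall k, vle wl (w k) /\ vle (w k) wu.
Hypothesis vP : forall k i, vle (vl i) (v k i) /\ vle (v k i) (vu i).

Lemma subr_nonneg_mx n' (a b : 'cV[R]_n') : vle a b -> nonneg_mx (b - a).
Proof. by move=> ab i j; rewrite ord1 !mxE subr_ge0. Qed.

Lemma dio_noise_ge0 k r : 0 <= dio_noise k r 0.
Proof.
have [i [b [s ->]]] := cposP r; rewrite dio_noiseE /side_noise.
have [w1 w2] := wP k; have [v1 v2] := vP k i; have [v3 v4] := vP k.+1 i.
by case: ifP => _; rewrite addmx3E !addr_ge0// gap_ge0//; exact: subr_nonneg_mx.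
Qed.

(** This is the framer property: each later error entry equals an entry of [Ahat e + g], which is
    nonnegative by induction. *)
Lemma dio_err_ge0 k r : 0 <= dio_err k r 0.
Proof.
elim: k r => [|k IH] r.
  have [i [b [s ->]]] := cposP r; rewrite dio_errE /side_err.
  by case: ifP => _; rewrite !mxE subr_ge0.
have [t _ ->] := (dio_err_step k r).2.
rewrite addmxE addr_ge0 ?dio_noise_ge0//.
by apply: nonneg_mulmx; [exact: Ahat_ge0|move=> i j; rewrite ord1].
Qed.

Definition noise_gain : R :=
  2 * \sum_i (mxmass (TB i) + mxmass (L i *m D i) + mxmass (Gam i *m D i)).

Lemma noise_gain_ge0 : 0 <= noise_gain.
Proof.
by rewrite mulr_ge0// sumr_ge0// => i _; rewrite !addr_ge0// mxmass_ge0.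
Qed.

(** The update uses the next output, hence the noise at [k.+1] too. The 2 in [noise_gain] comes from
    differences of two vectors bounded by [c]. *)
Lemma dio_noise_le k r (c : R) :
  delta_norm wl wu vl vu w v k <= c -> delta_norm wl wu vl vu w v k.+1 <= c ->
  dio_noise k r 0 <= noise_gain * c.
Proof.
rewrite /delta_norm 2!ge_max => /andP[/andP[wc] + /bigmax_leP[c0 vc]].
rewrite ge_max => /andP[wlc wuc].
rewrite ge_max => /andP[_ /bigmax_leP[_ vc']].
have diff n' (a b : 'cV[R]_n') s : vnorm a <= c -> vnorm b <= c -> (a - b) s 0 <= 2 * c.
  move=> ac bc; rewrite !(addmxE, oppmxE).
  have := le_trans (vnorm_ge a s) ac; have := le_trans (vnorm_ge b s) bc.
  by rewrite !ler_norml => /andP[? _] /andP[_ ?]; lra.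
have [i [b [s ->]]] := cposP r; rewrite dio_noiseE /side_noise.
have := vc i isT; rewrite 2!ge_max => /and3P[vk vlc vuc].
have := vc' i isT; rewrite 2!ge_max => /and3P[vk' _ _].
have c20 : 0 <= 2 * c by rewrite mulr_ge0.
apply: (@le_trans _ _ ((mxmass (TB i) + mxmass (L i *m D i)
  + mxmass (Gam i *m D i)) * (2 * c))).
  by case: ifP => _;
    rewrite addmx3E [leRHS]mulrDl [X in _ <= X + _]mulrDl !lerD// gap_le// => s'; exact: diff.
rewrite mulrCA /noise_gain -mulrA ler_pM2l// ler_wpM2r//.
rewrite [leRHS](bigD1 i)//= lerDl sumr_ge0// => j _.
by rewrite !addr_ge0// mxmass_ge0.
Qed.
End Errors.

(** * Stability estimates and the two equivalences *)

Lemma delta_norm0 (R : realType) m N (q : 'I_N -> nat) k :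
  delta_norm (0 : 'cV[R]_m) 0 (fun i => 0 : 'cV[R]_(q i)) (fun=> 0)
    (fun=> 0) (fun _ _ => 0) k = 0.
Proof.
have v0 n : vnorm (0 : 'cV[R]_n) = 0.
  by apply: bigmax_eq_id => s _; rewrite mxE normr0.
rewrite /delta_norm !v0 !maxxx bigmax_eq_id ?maxxx// => i _.
by rewrite !v0 !maxxx.
Qed.

Section Stability.
Variables (R : realType) (n m N : nat) (p q : 'I_N -> nat).
Variables (A : 'M[R]_n) (B : 'M[R]_(n, m))
          (C : forall i, 'M[R]_(p i, n)) (D : forall i, 'M[R]_(p i, q i))
          (L : forall i, 'M[R]_(n, p i)) (Gam : forall i, 'M[R]_(n, p i))
          (E : rel 'I_N) (d : nat).

Local Notation err := (err_norm A B C D L Gam E d).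
Local Notation err0 x0 xl0 xu0 := (err_norm A B C D L Gam E d 0 0
  (fun _ => 0) (fun _ => 0) x0 xl0 xu0 (fun _ => 0) (fun _ _ => 0)).

Lemma err_norm_schur_bound (H : 'M[R]_(CN N n)) :
  in_Hd E d H -> schur_stable (H *m Ahat A C L Gam) ->
  exists c mu c' : R, [/\ 0 < c, 0 < mu, mu < 1, 0 < c' &
    forall wl wu vl vu x0 xl0 xu0 w v,
    vle xl0 x0 -> vle x0 xu0 ->
    (forall k, vle wl (w k) /\ vle (w k) wu) ->
    (forall k i, vle (vl i) (v k i) /\ vle (v k i) (vu i)) ->
    forall k, err wl wu vl vu x0 xl0 xu0 w v k
      <= c * mu ^+ k * err wl wu vl vu x0 xl0 xu0 w v 0
         + c' * \big[Num.max/0]_(l < k.+1) delta_norm wl wu vl vu w v l].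
Proof.
move=> /in_Hd_selector sH sM.
have [c [mu [c0 mu0 mu1 bound]]] := nbmin_geometric_bound (Ahat_ge0 A C L Gam) sH sM.
pose G := noise_gain B C D L Gam.
have G0 : 0 <= G by exact: noise_gain_ge0.
have cm : 0 < c / (1 - mu) by rewrite divr_gt0// subr_gt0.
(* Adding 1 keeps the coefficient positive when the noise gain is 0. *)
exists c, mu, (c / (1 - mu) * (G + 1)); split=> //.
  by rewrite mulr_gt0//; lra.
move=> wl wu vl vu x0 xl0 xu0 w v hl hu hw hv k.
set del := \big[Num.max/0]_(l < k.+1) _.
have del0 : 0 <= del by exact: bigmax_ge_id.
have dell l : (l <= k)%N -> delta_norm wl wu vl vu w v l <= del.
  move=> lk; exact: (le_bigmax _ (fun l : 'I_k.+1 => delta_norm wl wu vl vu w v l)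
    (Ordinal (lk : (l < k.+1)%N))).
have e0 := err_norm_ge0 A B C D L Gam E d wl wu vl vu x0 xl0 xu0 w v 0.
apply: err_norm_le => [|r].
  rewrite addr_ge0// mulr_ge0//; last by rewrite mulr_ge0 ?(ltW cm)//; lra.
  by rewrite mulr_ge0 ?exprn_ge0 ?ltW.
rewrite ger0_norm; last exact: dio_err_ge0.
apply: (@le_trans _ _ (c * mu ^+ k * err wl wu vl vu x0 xl0 xu0 w v 0
                       + c / (1 - mu) * (G * del))).
  apply: (bound _ (dio_noise B C D L Gam wl wu vl vu w v)) => //.
  - by rewrite mulr_ge0.
  - by move=> l; exact: dio_err_step.
  - by move=> s; apply: le_trans (ler_norm _) _; exact: dio_err_le.
  (* As [l < k], both [l] and [l.+1] lie in the window up to [k]. *)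
  - by move=> l s lk; apply: dio_noise_le; apply: dell => //; exact: ltnW.
by rewrite lerD2l -[leRHS]mulrA ler_pM2l// ler_wpM2r//; lra.
Qed.

(** State 0 framed by [[-1, 1]] makes every initial error entry 1; without disturbances the
    recursion is that of [nbmin_contraction_selector]. *)
Lemma schur_of_err_norm_contraction k :
  err0 0 (const_mx (-1)) (const_mx 1) k.+1 <= 1 / 2 ->
  exists H : 'M[R]_(CN N n), in_Hd E d H /\ schur_stable (H *m Ahat A C L Gam).
Proof.
move=> h.
pose e := dio_err A B C D L Gam E d 0 0 (fun _ => 0) (fun _ => 0)
  0 (const_mx (-1)) (const_mx 1) (fun _ => 0) (fun _ _ => 0).
have noise0 l : dio_noise B C D L Gam 0 0 (fun _ => 0) (fun _ => 0)
    (fun _ => 0) (fun _ _ => 0) l = 0 :> 'cV[R]_(CN N n).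
  apply/matrixP => r z; rewrite ord1; have [i [b [s ->]]] := cposP r.
  by rewrite dio_noiseE /side_noise /gap !subr0 !mulmx0 !addr0 if_same !mxE.
suff [H sH HS] : exists2 H, is_selector (@cnbhd n N E d) H &
    schur_stable (H *m Ahat A C L Gam).
  by exists H; split=> //; apply/in_Hd_selector.
apply: (@nbmin_contraction_selector _ _ _ _ e k).
- exact: cnbhd_refl.
- exact: Ahat_ge0.
- apply/matrixP => r z; rewrite ord1; have [i [b [s ->]]] := cposP r.
  rewrite /e dio_errE /side_err /=.
  by case: ifP => _; rewrite !mxE; lra.
- move=> l; rewrite -[X in is_nbmin _ X]addr0 -(noise0 l); exact: dio_err_step.
- move=> r; apply: le_trans (ler_norm _) _; apply: le_trans h; exact: dio_err_le.
Qed.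

Lemma err_norm0_unit : err0 0 (const_mx (-1)) (const_mx 1) 0 <= 1.
Proof.
apply: err_norm_le => // r; have [i [b [s ->]]] := cposP r.
rewrite dio_errE /side_err /=.
by case: ifP => _; rewrite !mxE ?opprK ?add0r ?subr0 normr1.
Qed.
End Stability.

(** The time is a successor because the period to be closed needs at least one step. *)
Lemma cvg0_le_half (R : realType) (f : nat -> R) :
  (f k @[k --> \oo] --> 0)%classic -> exists k, f k.+1 <= 1 / 2.
Proof.
move=> f0; have h : (0 : R) < 1 / 2 by lra.
have [k _ hk] := cvgr_le _ f0 _ h.
by exists k; apply: hk => /=.
Qed.

Lemma classK_linear (R : realType) (c : R) : 0 < c -> classK (fun r => c * r).
Proof.
move=> c0; split; first by rewrite mulr0.
split; last by move=> r s _ rs; rewrite ltr_pM2l.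
by apply: continuous_subspaceT => r; exact: mulrl_continuous.
Qed.

Theorem theorem1 (R : realType) (n m N : nat) (p q : 'I_N -> nat)
  (A : 'M[R]_n) (B : 'M[R]_(n, m))
  (C : forall i, 'M[R]_(p i, n)) (D : forall i, 'M[R]_(p i, q i))
  (L : forall i, 'M[R]_(n, p i)) (Gam : forall i, 'M[R]_(n, p i))
  (E : rel 'I_N) (d : nat) :
  (* (1) noise-free collective error dynamics is GES  <->  some H in H_d
         with H * Ahat Schur *)
  ((exists c : R, exists lam : R, 0 < c /\ 0 < lam < 1 /\
     forall x0 xl0 xu0 : 'cV[R]_n, vle xl0 x0 -> vle x0 xu0 ->
     forall k : nat,
       err_norm A B C D L Gam E d 0 0 (fun _ => 0) (fun _ => 0) x0 xl0 xu0
                (fun _ => 0) (fun _ _ => 0) k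
       <= c * lam ^+ k *
          err_norm A B C D L Gam E d 0 0 (fun _ => 0) (fun _ => 0) x0 xl0 xu0
                (fun _ => 0) (fun _ _ => 0) 0)
   <-> exists H : 'M[R]_#|{: cidx N n}|,
         in_Hd E d H /\ schur_stable (H *m Ahat A C L Gam))
  /\
  (* (2) the DIO is input-to-state stable  <->  same condition *)
  ((exists (beta : R -> nat -> R) (gamma : R -> R),
     classKL beta /\ classKinf gamma /\
     forall (wl wu : 'cV[R]_m) (vl vu : forall i, 'cV[R]_(q i))
            (x0 xl0 xu0 : 'cV[R]_n)
            (w : nat -> 'cV[R]_m) (v : nat -> forall i, 'cV[R]_(q i)),
       vle xl0 x0 -> vle x0 xu0 ->
       (forall k, vle wl (w k) /\ vle (w k) wu) ->
       (forall k i, vle (vl i) (v k i) /\ vle (v k i) (vu i)) ->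
       forall k : nat,
         err_norm A B C D L Gam E d wl wu vl vu x0 xl0 xu0 w v k
         <= beta (err_norm A B C D L Gam E d wl wu vl vu x0 xl0 xu0 w v 0) k
            + gamma (\big[Num.max/0]_(l < k.+1)
                        delta_norm wl wu vl vu w v l))
   <-> exists H : 'M[R]_#|{: cidx N n}|,
         in_Hd E d H /\ schur_stable (H *m Ahat A C L Gam)).
Proof.
have vl1 : vle (const_mx (-1) : 'cV[R]_n) 0 by move=> s; rewrite !mxE lerN10.
have vu1 : vle (0 : 'cV[R]_n) (const_mx 1) by move=> s; rewrite !mxE ler01.
have vle0 k : vle (0 : 'cV[R]_k) 0 by move=> s.
have delta0 k : \big[Num.max/0]_(l < k) delta_norm (0 : 'cV[R]_m) 0
    (fun i => 0 : 'cV[R]_(q i)) (fun=> 0) (fun=> 0) (fun _ _ => 0) l = 0.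
  by apply: bigmax_eq_id => l _; rewrite delta_norm0.
have e1 := err_norm0_unit A B C D L Gam E d.
split; split.
- move=> [c [lam [c0 [/andP[l0 l1] ges]]]].
  have [|k hk] := @cvg0_le_half _ (geometric c lam).
    by apply: cvg_geometric; rewrite gtr0_norm.
  apply: (@schur_of_err_norm_contraction _ _ m _ _ q A B C D L Gam E d k).
  apply: le_trans (ges _ _ _ vl1 vu1 k.+1) _; apply: le_trans hk.
  by rewrite ler_piMr// mulr_ge0 ?exprn_ge0 ?ltW.
- move=> [H [hH hS]].
  have [c [mu [c' [c0 mu0 mu1 c'0 bound]]]] := err_norm_schur_bound B D hH hS.
  exists c, mu; split=> //; split; first by rewrite mu0.
  move=> x0 xl0 xu0 hl hu k.
  have := bound _ _ _ _ _ _ _ _ _ hl hu (fun _ => conj (vle0 m) (vle0 m))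
    (fun _ i => conj (vle0 (q i)) (vle0 (q i))) k.
  by rewrite delta0 mulr0 addr0.
(* Zero disturbances remove the [gamma] term, and an initial error of at most 1 lets [beta 1]
   dominate. *)
- move=> [beta [gamma [[bK [_ bL]] [[[g0 _] _] iss]]]].
  have [|k hk] := @cvg0_le_half _ (beta 1); first exact: bL.
  apply: (@schur_of_err_norm_contraction _ _ m _ _ q A B C D L Gam E d k).
  have := iss _ _ _ _ _ _ _ _ _ vl1 vu1 (fun _ => conj (vle0 m) (vle0 m))
    (fun _ i => conj (vle0 (q i)) (vle0 (q i))) k.+1.
  rewrite delta0 g0 addr0 => /le_trans; apply; apply: le_trans hk.
  (* [classK] states strict monotonicity, so equality with 1 is a separate case. *)
  move: e1; rewrite le_eqVlt => /predU1P[->//|e1].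
  by apply/ltW; have [_ [_ ->]] := bK k.+1; rewrite // err_norm_ge0.
- move=> [H [hH hS]].
  have [c [mu [c' [c0 mu0 mu1 c'0 bound]]]] := err_norm_schur_bound B D hH hS.
  exists (fun r k => c * mu ^+ k * r), (fun r => c' * r); split; [split|split].
  + by move=> k; apply: classK_linear; rewrite mulr_gt0// exprn_gt0.
  + split=> r r0 => [k|].
      by rewrite ler_wpM2r// ler_pM2l// exprS ler_piMl ?exprn_ge0 ?ltW.
    under eq_fun do rewrite mulrAC.
    by apply: cvg_geometric; rewrite gtr0_norm.
  + split=> [|M]; first exact: classK_linear.
    exists (`|M| / c'); split; first by rewrite divr_ge0// ltW.
    by rewrite mulrC divfK ?gt_eqF// ler_norm.
  + by move=> *; apply: bound.
Qed.
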